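(* Let $(S,\mathcal A)$ be a marked quantale, and let $t\colon S\to Id_{\mathcal A}(S)$ be given by $t(s)=s{\downarrow}$ for $s\in S$. Then $t$ is a reflection of $(S,\mathcal A)$ in the category of quantales. That is: $t$ is a marked quantale map $(S,\mathcal A)\to (Id_{\mathcal A}(S),\mathcal P(Id_{\mathcal A}(S)))$, and for every quantale $Q$ and every marked quantale map $f\colon (S,\mathcal A)\to (Q,\mathcal P(Q))$ there exists a unique quantale morphism $g\colon Id_{\mathcal A}(S)\to Q$ such that $g\circ t=f$.
   Context: A posemigroup is a semigroup with a partial order $\leqslant$ compatible with multiplication in both arguments; posemigroup morphisms are the monotone multiplicative maps. $S^1$ denotes $S$ if $S$ has an identity element, and otherwise $S$ with an identity $1$ adjoined. $\mathcal P(X)$ is the power set of $X$. A quantale is a posemigroup that is a complete lattice in which multiplication distributes over arbitrary joins in both arguments; quantale morphisms preserve multiplication and arbitrary joins. A marked posemigroup is a pair $(S,\mathcal A)$ with $S$ a posemigroup and $\mathcal A\subseteq\mathcal P(S)$ such that (A1) $\{a\}\in\mathcal A$ for all $a\in S$; (A2) if $G\in\mathcal A$ and $a,b\in S^1$, then $\{axb\mid x\in G\}\in\mathcal A$. Members of $\mathcal A$ are called admissible subsets. A marked posemigroup $(S,\mathcal A)$ is a marked quantale if every admissible subset $M$ has a join in $S$ and $a(\bigvee M)b=\bigvee (aMb)$ for all $a,b\in S^1$. A marked quantale map $f\colon(S,\mathcal A)\to(S',\mathcal A')$ is a posemigroup morphism $f\colon S\to S'$ such that $f(M)\in\mathcal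 A'$ and $f(\bigvee M)=\bigvee f(M)$ for every $M\in\mathcal A$. A quantale $Q$ is regarded as the marked quantale $(Q,\mathcal P(Q))$. For $X\subseteq S$, $X{\downarrow}=\{p\in S\mid p\leqslant x\text{ for some }x\in X\}$, and $s{\downarrow}=\{s\}{\downarrow}$. A lower subset is an $X\subseteq S$ with $X{\downarrow}=X$ ($\emptyset$ included). An $\mathcal A$-ideal of $S$ is a lower subset $D$ of $S$ such that $\bigvee M\in D$ for every $M\in\mathcal A$ with $M\subseteq D$. $Id_{\mathcal A}(S)$ is the set of all $\mathcal A$-ideals of $S$, ordered by inclusion. It is a quantale in which $V\cdot W=\bigcap\{D\in Id_{\mathcal A}(S)\mid vw\in D \text{ for all } v\in V, w\in W\}$ and $\bigvee_{i}D_i=\bigcap\{D\in Id_{\mathcal A}(S)\mid \bigcup_i D_i\subseteq D\}$. *)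

(* Defs.v *)
From HB Require Import structures.
From mathcomp Require Import all_boot all_order.
From mathcomp Require Import boolp classical_sets.

Set Implicit Arguments.
Unset Strict Implicit.
Unset Printing Implicit Defensive.

Import Order.TTheory.

Local Open Scope classical_set_scope.
Local Open Scope order_scope.
Local Open Scope group_scope.

HB.mixin Record isPosemigroup (d : Order.disp_t) T
    of Order.POrder d T & Semigroup T := {
  le_mulgl : forall a x y : T, x <= y -> a * x <= a * y;
  le_mulgr : forall a x y : T, x <= y -> x * a <= y * a
}.

#[short(type="posemigroupType")]
HB.structure Definition Posemigroup (d : Order.disp_t) :=
  {T of isPosemigroup d T & Order.POrder d T & Semigroup T}.

HB.mixin Record Posemigroup_isQuantale (d : Order.disp_t) T
    of Posemigroup d T := {
  ex_isLub : forall M : set T, exists m : T, isLub M m;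
  mulg_isLubl : forall (a : T) (M : set T) (m : T),
    isLub M m -> isLub [set a * x | x in M] (a * m);
  mulg_isLubr : forall (a : T) (M : set T) (m : T),
    isLub M m -> isLub [set x * a | x in M] (m * a)
}.

#[short(type="quantaleType")]
HB.structure Definition Quantale (d : Order.disp_t) :=
  {T of Posemigroup_isQuantale d T & Posemigroup d T}.

Definition posemigroup_morphism (d d' : Order.disp_t) (S : posemigroupType d)
    (T : posemigroupType d') (f : S -> T) : Prop :=
  {homo f : x y / x <= y} /\ {morph f : x y / x * y}.

Definition quantale_morphism (d d' : Order.disp_t) (P : quantaleType d)
    (Q : quantaleType d') (g : P -> Q) : Prop :=
  {morph g : x y / x * y} /\
  forall (M : set P) (m : P), isLub M m -> isLub (g @` M) (g m).

Section AdjoinedIdentity.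
Context (d : Order.disp_t) (S : posemigroupType d).

Definition has_identity : Prop :=
  exists e : S, forall x : S, e * x = x /\ x * e = x.

(* S^1 as a subset of option S: Some a stands for a \in S, and the adjoined
   identity None belongs to it only when S has no identity of its own. *)
Definition adjoin1 : set (option S) :=
  [set u | u = None -> ~ has_identity].

(* The product a x b in S, for a, b \in S^1 and x \in S. *)
Definition mul1l (a : option S) (x : S) : S := if a is Some s then s * x else x.
Definition mul1r (x : S) (b : option S) : S := if b is Some s then x * s else x.
Definition sandwich (a b : option S) (x : S) : S := mul1r (mul1l a x) b.

Definition marked_posemigroup (A : set (set S)) : Prop :=
  (forall a : S, A [set a]) /\
  (forall (G : set S) (a b : option S), A G -> adjoin1 a -> adjoin1 b ->
     A [set sandwich a b x | x in G]).

Definition marked_quantale (A : set (set S)) : Prop :=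
  marked_posemigroup A /\
  forall M : set S, A M -> exists m : S, isLub M m /\
    forall a b : option S, adjoin1 a -> adjoin1 b ->
      isLub [set sandwich a b x | x in M] (sandwich a b m).

End AdjoinedIdentity.

(* A marked quantale (S, A) is given by the posemigroup S together with
   A : marking S. *)
Record marking (d : Order.disp_t) (S : posemigroupType d) := Marking {
  admissible : set (set S);
  markingP : marked_quantale admissible
}.

Definition marked_quantale_map (d d' : Order.disp_t) (S : posemigroupType d)
    (S' : posemigroupType d') (A : marking S) (A' : marking S')
    (f : S -> S') : Prop :=
  posemigroup_morphism f /\
  forall M : set S, admissible A M ->
    admissible A' (f @` M) /\ forall m : S, isLub M m -> isLub (f @` M) (f m).

Section QuantaleMarking.
Context (d : Order.disp_t) (Q : quantaleType d).

Lemma marked_quantale_setT : @marked_quantale d Q [set: set Q].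
Proof.
split=> [//|M _]; have [m Mm] := ex_isLub M; exists m; split=> // a b _ _.
have Ml : isLub [set mul1l a x | x in M] (mul1l a m).
  by case: a => [s|] /=; [exact: mulg_isLubl | rewrite image_id].
have -> : [set sandwich a b x | x in M] =
          [set mul1r x b | x in [set mul1l a x | x in M]].
  by rewrite image_comp.
by case: b => [s|] /=; [exact: mulg_isLubr | rewrite image_id].
Qed.

Definition quantale_marking : marking Q := Marking marked_quantale_setT.

End QuantaleMarking.
Arguments quantale_marking {d} Q.

Section Ideals.
Context (d : Order.disp_t) (S : posemigroupType d) (A : marking S).
Implicit Types (D X Y : set S).

Definition lower_subset D : Prop := down D = D.

Definition is_ideal D : Prop :=
  lower_subset D /\
  forall (M : set S) (m : S), admissible A M -> M `<=` D -> isLub M m -> D m.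

Lemma lower_subsetP D :
  lower_subset D <-> forall x y : S, x <= y -> D y -> D x.
Proof.
split=> [DE x y xy Dy|Dle]; first by rewrite -DE; exists y.
apply/seteqP; split=> x /=; first by case=> y [Dy /Dle]; exact.
by move=> Dx; exists x.
Qed.

Lemma is_ideal_smallest X : is_ideal (smallest is_ideal X).
Proof.
split=> [|M m AM MX Mm D [idD XD]].
  apply/lower_subsetP => x y xy Xy D [idD XD].
  by apply: ((lower_subsetP D).1 idD.1 x y xy); exact: Xy.
by apply: (idD.2 M m) => // x /MX; exact.
Qed.

Lemma is_ideal_down1 (s : S) : is_ideal (down [set s]).
Proof.
split=> [|M m AM Ms [_ mP]].
  apply/lower_subsetP => x y xy [z [/= -> yz]].
  by exists s; split=> //; exact: le_trans yz.
exists s; split=> //; apply: mP => x /Ms [z [/= -> ]]; exact.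
Qed.

Record Id : Type := mkId { idset : set S; Id_P : is_ideal idset }.

HB.instance Definition _ := gen_eqMixin Id.
HB.instance Definition _ := gen_choiceMixin Id.

Definition leId (V W : Id) : bool := `[< idset V `<=` idset W >].

Lemma Id_inj (V W : Id) : idset V `<=` idset W -> idset W `<=` idset V -> V = W.
Proof.
case: V W => [V iV] [W iW] /= VW WV.
have E : V = W by exact/seteqP.
by move: iV; rewrite E => iV; congr mkId; exact: Prop_irrelevance.
Qed.

Lemma leId_refl : reflexive leId.
Proof. by move=> V; exact/asboolP. Qed.

Lemma leId_anti : antisymmetric leId.
Proof. by move=> V W /andP[/asboolP VW /asboolP WV]; exact: Id_inj. Qed.

Lemma leId_trans : transitive leId.
Proof.
by move=> V U W /asboolP UV /asboolP VW; apply/asboolP/(subset_trans UV VW).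
Qed.

HB.instance Definition _ :=
  Order.Le_isPOrder.Build set_display Id leId_refl leId_anti leId_trans.

Lemma leIdE (V W : Id) : (V <= W) = (idset V `<=` idset W) :> Prop.
Proof. exact: asboolE. Qed.

Definition mulId (V W : Id) : Id :=
  mkId (is_ideal_smallest [set v * w | v in idset V & w in idset W]).

Definition principal (s : S) : Id := mkId (is_ideal_down1 s).

Lemma adjoin1_unit : exists u : option S, adjoin1 u /\
  (forall x, mul1l u x = x) /\ (forall x, mul1r x u = x).
Proof.
have [[e eP]|noe] := pselect (has_identity S).
  by exists (Some e); split=> //; split=> x /=; have [] := eP x.
by exists None; split.
Qed.

Lemma is_ideal_sandwich D (a b : option S) : is_ideal D ->
  adjoin1 a -> adjoin1 b -> is_ideal [set x | D (sandwich a b x)].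
Proof.
move=> [/lower_subsetP lD jD] a1 b1; split.
  apply/lower_subsetP => x y xy /=; apply: lD.
  have axy : mul1l a x <= mul1l a y by case: (a) => [s|] //=; exact: le_mulgl.
  by rewrite /sandwich; case: (b) => [s|] //=; exact: le_mulgr.
move=> M m AM MD Mm /=; have [[_ A2] /(_ M AM)] := markingP A.
case=> m' [Mm' /(_ a b a1 b1)].
have -> : m' = m.
  by apply/le_anti; rewrite (Mm'.2 _ Mm.1) (Mm.2 _ Mm'.1).
apply: jD; first exact: A2.
by move=> _ [x Mx <-]; exact: MD.
Qed.

Lemma is_ideal_mulgl D (a : S) : is_ideal D -> is_ideal [set x | D (a * x)].
Proof.
move=> iD; have [u [u1 [_ uE]]] := adjoin1_unit.
have := @is_ideal_sandwich D (Some a) u iD.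
by under eq_set => x do rewrite /sandwich uE /=; exact.
Qed.

Lemma is_ideal_mulgr D (a : S) : is_ideal D -> is_ideal [set x | D (x * a)].
Proof.
move=> iD; have [u [u1 [uE _]]] := adjoin1_unit.
have := @is_ideal_sandwich D u (Some a) iD.
by under eq_set => x do rewrite /sandwich uE /=; exact.
Qed.

Lemma mem_mulId (V W : Id) (v w : S) :
  idset V v -> idset W w -> idset (mulId V W) (v * w).
Proof. by move=> Vv Ww; apply: sub_gen_smallest; exists v => //; exists w. Qed.

Lemma mulId_sub (V W : Id) D : is_ideal D ->
  (forall v w, idset V v -> idset W w -> D (v * w)) -> idset (mulId V W) `<=` D.
Proof.
by move=> iD VWD; apply: smallest_sub => // _ [v Vv [w Ww <-]]; exact: VWD.
Qed.

Lemma mulIdA : associative mulId.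
Proof.
move=> U V W; apply: Id_inj; apply: mulId_sub (Id_P _) _.
- move=> u x Uu; move: x.
  apply: (mulId_sub (D := [set x | idset (mulId (mulId U V) W) (u * x)])).
    exact/is_ideal_mulgl/Id_P.
  by move=> v w Vv Ww /=; rewrite mulgA; exact: mem_mulId (mem_mulId Uu Vv) Ww.
- move=> x w + Ww; move: x.
  apply: (mulId_sub (D := [set x | idset (mulId U (mulId V W)) (x * w)])).
    exact/is_ideal_mulgr/Id_P.
  by move=> u v Uu Vv /=; rewrite -mulgA; exact: mem_mulId Uu (mem_mulId Vv Ww).
Qed.

HB.instance Definition _ := isSemigroup.Build Id mulIdA.

Lemma le_mulIdl (U V W : Id) : V <= W -> (U * V : Id) <= U * W.
Proof.
rewrite !leIdE => VW; apply: mulId_sub (Id_P _) _ => u v Uu /VW.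
exact: mem_mulId.
Qed.

Lemma le_mulIdr (U V W : Id) : V <= W -> (V * U : Id) <= W * U.
Proof.
rewrite !leIdE => VW; apply: mulId_sub (Id_P _) _ => v u /VW Wv.
exact: mem_mulId.
Qed.

HB.instance Definition _ := isPosemigroup.Build _ Id le_mulIdl le_mulIdr.

Definition joinId (F : set Id) : Id :=
  mkId (is_ideal_smallest (\bigcup_(V in F) idset V)).

Lemma joinId_isLub (F : set Id) : isLub F (joinId F).
Proof.
split=> [V FV|W FW]; rewrite leIdE.
  by move=> v Vv; apply: sub_gen_smallest; exists V.
apply: smallest_sub (Id_P _) _ => v [V FV Vv].
by have := FW V FV; rewrite leIdE; exact.
Qed.

Lemma isLub_joinId (F : set Id) (V : Id) : isLub F V -> V = joinId F.
Proof.
move=> FV; have FJ := joinId_isLub F.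
by apply/le_anti; rewrite (FV.2 _ FJ.1) (FJ.2 _ FV.1).
Qed.

Lemma ex_isLubId (F : set Id) : exists V : Id, isLub F V.
Proof. by exists (joinId F); exact: joinId_isLub. Qed.

Lemma mulId_isLubl (U : Id) (F : set Id) (V : Id) :
  isLub F V -> isLub [set (U * W : Id) | W in F] (U * V).
Proof.
move=> FV; split=> [_ [W FW <-]|W UFW]; first exact/le_mulIdl/FV.1.
rewrite (isLub_joinId FV) leIdE; apply: mulId_sub (Id_P _) _ => u x Uu.
move: x; apply: (smallest_sub (X := [set x | idset W (u * x)])).
  exact/is_ideal_mulgl/Id_P.
move=> x [X FX Xx] /=.
have := UFW (U * X) (imageP _ FX); rewrite leIdE; apply; exact: mem_mulId.
Qed.

Lemma mulId_isLubr (U : Id) (F : set Id) (V : Id) :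
  isLub F V -> isLub [set (W * U : Id) | W in F] (V * U).
Proof.
move=> FV; split=> [_ [W FW <-]|W UFW]; first exact/le_mulIdr/FV.1.
rewrite (isLub_joinId FV) leIdE; apply: mulId_sub (Id_P _) _ => x u + Uu.
move: x; apply: (smallest_sub (X := [set x | idset W (x * u)])).
  exact/is_ideal_mulgr/Id_P.
move=> x [X FX Xx] /=.
have := UFW (X * U) (imageP _ FX); rewrite leIdE; apply; exact: mem_mulId.
Qed.

HB.instance Definition _ :=
  Posemigroup_isQuantale.Build _ Id ex_isLubId mulId_isLubl mulId_isLubr.

End Ideals.
Arguments principal {d S} A s.

(* Main.v *)
(* Every ideal is the join of the principal ideals it contains, so g is forced
   to be V |-> \/ f(V). For each q : Q the set {s | f s <= q} is itself an ideal,
   because f is monotone and preserves admissible joins; hence a bound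
   \/ f(X) <= q extends from X to the ideal generated by X, which gives the
   preservation of products and joins by g. *)
Require Import Defs.
From mathcomp Require Import all_boot all_order.
From mathcomp Require Import boolp classical_sets.

Set Implicit Arguments.
Unset Strict Implicit.
Unset Printing Implicit Defensive.

Import Order.TTheory.

Local Open Scope classical_set_scope.
Local Open Scope order_scope.
Local Open Scope group_scope.

Lemma isLub_unique (d : Order.disp_t) (T : porderType d) (M : set T) (x y : T) :
  isLub M x -> isLub M y -> x = y.
Proof. by move=> Mx My; apply/le_anti; rewrite (Mx.2 _ My.1) (My.2 _ Mx.1). Qed.

Section Principal.
Context (d : Order.disp_t) (S : posemigroupType d) (A : marking S).
Implicit Types (V W : Id A) (s x y : S).

Lemma idset_le V x y : x <= y -> idset V y -> idset V x.
Proof. exact: ((lower_subsetP (idset V)).1 (Id_P V).1). Qed.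

Lemma mem_principal s x : idset (principal A s) x <-> x <= s.
Proof. by split=> [[y [/= -> ]] //|xs]; exists s. Qed.

(** Trades inclusions of principal ideals for membership; the facts about [principal] below reduce
    to it. *)
Lemma principal_le V s : principal A s <= V <-> idset V s.
Proof.
rewrite leIdE; split=> [|Vs x /mem_principal xs]; last exact: idset_le Vs.
by apply; exact/mem_principal.
Qed.

Lemma isLub_principal V : isLub (principal A @` idset V) V.
Proof.
split=> [_ [s Vs <-]|W VW]; first exact/principal_le.
by rewrite leIdE => s Vs; apply/principal_le/VW; exact: imageP.
Qed.

Lemma principal_homo : {homo principal A : x y / x <= y}.
Proof. by move=> x y xy; apply/principal_le; exact/mem_principal. Qed.

Lemma principalM : {morph principal A : x y / x * y}.
Proof.
move=> x y; apply/le_anti/andP; split.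
  by apply/principal_le; apply: mem_mulId; exact/mem_principal.
(* The down-set of [x * y] is already an ideal, so only the generating products [v * w] with
   [v <= x], [w <= y] need checking. *)
rewrite leIdE; apply: mulId_sub (Id_P _) _ => v w /mem_principal vx.
move=> /mem_principal wy; apply/mem_principal.
exact: le_trans (le_mulgl _ _ _ wy) (le_mulgr _ _ _ vx).
Qed.

Lemma principal_marked_quantale_map :
  marked_quantale_map A (quantale_marking (Id A)) (principal A).
Proof.
split=> [|M AM]; first by split; [exact: principal_homo | exact: principalM].
split=> // m Mm; split=> [_ [s Ms <-]|V MV].
  exact/principal_homo/Mm.1.
(* An upper bound [V] of the principal ideals of [M] contains [M], hence also [m], since ideals are
   closed under admissible joins. *)
apply/principal_le/((Id_P V).2 M m AM _ Mm) => s Ms.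
by apply/principal_le/MV; exact: imageP.
Qed.

End Principal.

Section Extension.
Context (d d' : Order.disp_t) (S : posemigroupType d) (A : marking S).
Context (Q : quantaleType d') (f : S -> Q).
Hypothesis fP : marked_quantale_map A (quantale_marking Q) f.

Lemma is_ideal_le_preimage (q : Q) : is_ideal A [set s | f s <= q].
Proof.
split=> [|M m AM Mq Mm /=].
  by apply/lower_subsetP => x y /(fP.1.1 x y) fxy /=; exact: le_trans.
by apply: ((fP.2 M AM).2 m Mm).2 => _ [s Ms <-]; exact: Mq.
Qed.

(** Joins in [Q] are only known to exist, so [g] is any function that picks them out. *)
Context (g : Id A -> Q).
Hypothesis gP : forall V : Id A, isLub (f @` idset V) (g V).

Lemma extension_ge (V : Id A) (s : S) : idset V s -> f s <= g V.
Proof. by move=> Vs; apply: (gP V).1; exact: imageP. Qed.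

Lemma extension_le (V : Id A) (q : Q) :
  idset V `<=` [set s | f s <= q] -> g V <= q.
Proof. by move=> Vq; apply: (gP V).2 => _ [s Vs <-]; exact: Vq. Qed.

Lemma extensionM : {morph g : V W / V * W}.
Proof.
move=> V W; apply/le_anti/andP; split.
  apply: extension_le; apply: mulId_sub; first exact: is_ideal_le_preimage.
  move=> v w Vv Ww /=; rewrite fP.1.2.
  apply: le_trans (le_mulgl _ _ _ (extension_ge Ww)) _.
  exact/le_mulgr/extension_ge.
(* Distributivity in [Q], one factor at a time, reduces the bound on [g V * g W] to bounds on the
   products [f v * f w]. *)
apply: (mulg_isLubr (g W) _ _ (gP V)).2 => _ [_ [v Vv <-] <-].
apply: (mulg_isLubl (f v) _ _ (gP W)).2 => _ [_ [w Ww <-] <-].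
by rewrite -fP.1.2; apply: extension_ge; exact: mem_mulId.
Qed.

Lemma extension_isLub (F : set (Id A)) (V : Id A) :
  isLub F V -> isLub (g @` F) (g V).
Proof.
move=> FV; split=> [_ [W FW <-]|q Fq].
  apply: extension_le => s Ws; apply: extension_ge.
  by have := FV.1 W FW; rewrite leIdE; exact.
rewrite (isLub_joinId FV); apply: extension_le.
apply: smallest_sub (is_ideal_le_preimage q) _ => s [W FW Ws].
exact: le_trans (extension_ge Ws) (Fq _ (imageP g FW)).
Qed.

(** The down-set of [s] has greatest element [s] and [f] is monotone, so the join of its image is
    [f s]. *)
Lemma extension_principal : g \o principal A = f.
Proof.
apply/funext => s; apply/le_anti/andP; split.
  by apply: extension_le => x /mem_principal; exact: fP.1.1.
exact/extension_ge/mem_principal.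
Qed.

End Extension.

Lemma quantale_morphism_isLub (d d' : Order.disp_t) (S : posemigroupType d)
    (A : marking S) (Q : quantaleType d') (h : Id A -> Q) (V : Id A) :
  quantale_morphism h -> isLub ((h \o principal A) @` idset V) (h V).
Proof. by move=> hP; rewrite -image_comp; exact/hP.2/isLub_principal. Qed.

Theorem theorem3p3 (d : Order.disp_t) (S : posemigroupType d) (A : marking S) :
  marked_quantale_map A (quantale_marking (Id A)) (principal A) /\
  forall (d' : Order.disp_t) (Q : quantaleType d') (f : S -> Q),
    marked_quantale_map A (quantale_marking Q) f ->
    exists! g : Id A -> Q, quantale_morphism g /\ g \o principal A = f.
Proof.
split=> [|d' Q f fP]; first exact: principal_marked_quantale_map.
have [g gP] := choice (fun V : Id A => ex_isLub (f @` idset V)).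
exists g; split=> [|h [hP hf]].
  split; last exact: (extension_principal fP).
  by split; [exact: (extensionM fP) | exact: (extension_isLub fP)].
(* Both [g V] and [h V] are least upper bounds of the image of [V] under [f]. *)
apply/funext => V; apply: isLub_unique (gP V) _.
by rewrite -hf; exact: quantale_morphism_isLub.
Qed.
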